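(* Let $c>0$ be fixed. There exist $c_0>0$ and $n_0$ (depending only on $c$) such that for every $n\ge n_0$ and for every coupling of the random multigraphs $\mathbb G_{\mathrm{PAG}}(n)$ and $\mathbb G_W(n)$, $$\mathbb E\big(d_{\boxtimes}(\mathbb G_{\mathrm{PAG}}(n),\mathbb G_W(n))\big)\ge \frac{c_0}{n}.$$
   Context: The parameter $c>0$ is fixed throughout. All multigraphs are undirected and have vertex set $[n]=\{1,\dots,n\}$. A coupling of two random multigraphs is a realization of both on a common probability space. Jumble norm distance: for multigraphs $G,H$ on $[n]$ with edge multiplicities $U_{ij}=U_{ji}$ in $G$ and $V_{ij}=V_{ji}$ in $H$ ($U_{ii},V_{ii}$ being the number of loops at $i$), $$d_{\boxtimes}(G,H)=\frac1n\max_{\emptyset\ne S,T\subseteq[n]}\frac1{\sqrt{|S|\,|T|}}\Big|\sum_{i\in S,\,j\in T}(U_{ij}-V_{ij})\Big|.$$ $\mathbb G_{\mathrm{PAG}}(n)$: assign an urn to each vertex of $[n]$, initially with one ball in each. For $t=1,2,\dots,\lfloor cn^2\rfloor$, at step $t$ choose an urn with probability proportional to its current number of balls (each choice being conditionally independent of the previous steps given the current distribution of balls) and put one new ball into it. Then, for $k=1,\dots,\lfloor\lfloor cn^2\rfloor/2\rfloor$, add an edge between the vertices whose urns received the balls at steps $2k-1$ and $2k$. Multiple edges and loops may occur. $\mathbb G_W(n)$: let $\xi_1,\dots,\xi_n$ be independent exponential random variables with parameter $1$. Conditionally on the $\xi_i$'s, let $Y_{ij}$ ($1\le i<j\le n$)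 be independent Poisson random variables with parameter $c\xi_i\xi_j$. Put $Y_{ij}$ edges between $i$ and $j$ for every $1\le i<j\le n$; there are no loops. *)

(* Defs.v *)
From HB Require Import structures.
From mathcomp Require Import all_boot all_order all_algebra.
From mathcomp Require Import all_classical all_reals all_analysis.

Set Implicit Arguments.
Unset Strict Implicit.
Unset Printing Implicit Defensive.

Import Order.TTheory GRing.Theory Num.Theory.

Local Open Scope classical_set_scope.
Local Open Scope ring_scope.

(* A multigraph on {0, ..., n-1}, given by its symmetric matrix of edge
   multiplicities.  The diagonal entry at i is the number of loops at i, each
   loop being counted once. *)
Record multigraph (n : nat) : Type := Multigraph {
  mult :> 'M[nat]_n ;
  mult_sym : mult^T == mult }.

HB.instance Definition _ n := [isSub for @mult n].
HB.instance Definition _ n := [Countable of multigraph n by <:].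

Fact empty_multigraph_sym n : (const_mx 0%N : 'M[nat]_n)^T == const_mx 0%N.
Proof. by rewrite trmx_const. Qed.

HB.instance Definition _ n :=
  isPointed.Build (multigraph n) (Multigraph (empty_multigraph_sym n)).

(* The set of multigraphs is countable; it carries the discrete
   sigma-algebra. *)
HB.instance Definition _ n := @isMeasurable.Build default_measure_display
  (multigraph n) discrete_measurable discrete_measurable0
  discrete_measurableC discrete_measurableU.

(* All the terms of the maximum are nonnegative, so 0 is a harmless default
   value; it is only reached when n = 0. *)
Definition jumble_dist (R : realType) (n : nat) (G H : multigraph n) : R :=
  n%:R^-1 *
  \big[Num.max/0]_(ST : {set 'I_n} * {set 'I_n}
                   | (ST.1 != finset.set0) && (ST.2 != finset.set0))
    ((Num.sqrt (#|ST.1|%:R * #|ST.2|%:R))^-1 *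
     `| \sum_(i in ST.1) \sum_(j in ST.2) ((G i j)%:R - (H i j)%:R) |).

(** Preferential attachment *)

(* The number of balls in the urn v, when the urns start with one ball each and
   the balls added so far went successively to the urns listed in h. *)
Definition balls (n : nat) (h : seq 'I_n) (v : 'I_n) : nat :=
  (1 + count_mem v h)%N.

(* X t is the urn receiving the ball of the (t+1)-st step, for t < m.  The
   conditional probability of each choice given the whole history is written in
   multiplied-out form, so that histories of probability 0 need no special
   treatment.  Nothing is required of X t for t >= m. *)
Definition urn_process (R : realType) (n m : nat) (d : measure_display)
    (T : measurableType d) (P : probability T R) (X : nat -> T -> 'I_n) : Prop :=
  (forall t v, (t < m)%N -> measurable [set w | X t w = v]) /\
  (forall t (h : t.-tuple 'I_n) v, (t < m)%N ->
     P [set w | (forall s : 'I_t, X s w = tnth h s) /\ X t w = v] =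
     (P [set w | forall s : 'I_t, X s w = tnth h s] *
      ((balls h v)%:R / (\sum_(u < n) balls h u)%N%:R)%:E)%E).

(* The edges join x (2k) and x (2k+1), for k < floor(m / 2). *)
Definition pairing_mx (n m : nat) (x : nat -> 'I_n) : 'M[nat]_n :=
  \matrix_(i, j) (\sum_(k < m./2)
    (((x k.*2, x k.*2.+1) == (i, j)) || ((x k.*2, x k.*2.+1) == (j, i))))%N.

Fact pairing_sym n m (x : nat -> 'I_n) : (pairing_mx m x)^T == pairing_mx m x.
Proof.
by apply/eqP/matrixP => i j; rewrite !mxE; apply: eq_bigr => k _; rewrite orbC.
Qed.

Definition pairing_graph (n m : nat) (x : nat -> 'I_n) : multigraph n :=
  Multigraph (pairing_sym m x).

(* G has the law of the preferential attachment multigraph.  The urn process is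
   not required to live on the probability space on which G is defined. *)
Definition is_PAG (R : realType) (c : R) (n : nat) (d : measure_display)
    (T : measurableType d) (P : probability T R)
    (G : {RV P >-> multigraph n}) : Prop :=
  let m := Num.truncn (c * n%:R ^+ 2) in
  exists (d' : measure_display) (T' : measurableType d') (P' : probability T' R)
         (X : nat -> T' -> 'I_n),
    urn_process m P' X /\
    forall A : set (multigraph n),
      P (G @^-1` A) = P' [set w | A (pairing_graph m (X ^~ w))].

(** W-random multigraph *)

Definition iid_exponential (R : realType) (n : nat) (d : measure_display)
    (T : measurableType d) (P : probability T R)
    (xi : 'I_n -> {RV P >-> R}) : Prop :=
  forall B : 'I_n -> set R, (forall i, measurable (B i)) ->
    P [set w | forall i, B i (xi i w)] =
    (\prod_(i < n) exponential_prob 1 (B i))%E.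

(* Given xi, the Y i j with i < j are independent and Poisson distributed with
   parameter c * xi i * xi j: the displayed product is the conditional
   probability, given the sigma-algebra generated by xi, that Y i j = k i j for
   all i < j.  Nothing is required of Y i j for j <= i.  The second argument of
   poisson_prob is a dummy. *)
Definition cond_poisson (R : realType) (c : R) (n : nat) (d : measure_display)
    (T : measurableType d) (P : probability T R)
    (xi : 'I_n -> {RV P >-> R}) (Y : 'I_n -> 'I_n -> {RV P >-> nat}) : Prop :=
  forall (B : set (n.-tuple R)) (k : 'I_n -> 'I_n -> nat), measurable B ->
    P [set w | B [tuple xi i w | i < n] /\
               forall i j : 'I_n, (i < j)%N -> Y i j w = k i j] =
    (\int[P]_(w in [set w | B [tuple xi i w | i < n]])
       \prod_(i < n) \prod_(j < n | (i < j)%N)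
         poisson_prob (c * xi i w * xi j w)%R 0%N [set k i j])%E.

Definition upper_mx (n : nat) (y : 'I_n -> 'I_n -> nat) : 'M[nat]_n :=
  \matrix_(i, j)
    (if (i < j)%N then y i j else if (j < i)%N then y j i else 0%N).

Fact upper_sym n (y : 'I_n -> 'I_n -> nat) : (upper_mx y)^T == upper_mx y.
Proof. by apply/eqP/matrixP => i j; rewrite !mxE; case: ltngtP. Qed.

Definition upper_graph (n : nat) (y : 'I_n -> 'I_n -> nat) : multigraph n :=
  Multigraph (upper_sym y).

(* H has the law of the W-random multigraph; again, xi and Y may live on another
   probability space. *)
Definition is_GW (R : realType) (c : R) (n : nat) (d : measure_display)
    (T : measurableType d) (P : probability T R)
    (H : {RV P >-> multigraph n}) : Prop :=
  exists (d' : measure_display) (T' : measurableType d') (P' : probability T' R)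
         (xi : 'I_n -> {RV P' >-> R}) (Y : 'I_n -> 'I_n -> {RV P' >-> nat}),
    [/\ iid_exponential xi,
        cond_poisson c xi Y &
        forall A : set (multigraph n),
          P (H @^-1` A) = P' [set w | A (upper_graph (fun i j => Y i j w))]].

(* Main.v *)
(* Loops alone separate the two laws.  G_W never has a loop.  In the urn process
   the two balls of the (k+1)-st pair fall into the same urn with conditional
   probability at least 2 / (n + 2k + 1), so the probability that the first k
   pairs give no loop is at most n / (n + 2k), by the telescoping estimate
   (b - 1)(b + 2) <= b (b + 1) with b = n + 2k.  As floor(c n^2) exceeds n for
   large n, G_PAG has a loop with probability at least 1/2.  Finally, two
   different multigraphs are at jumble distance at least 1/n, as singletons S
   and T show. *)
Require Import Defs.
From HB Require Import structures.
From mathcomp Require Import all_boot all_order all_algebra.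
From mathcomp Require Import all_classical all_reals all_analysis.
From mathcomp Require Import measurable_realfun ring lra zify.

Import Order.TTheory GRing.Theory Num.Theory.

Local Open Scope classical_set_scope.
Local Open Scope ring_scope.

Set Implicit Arguments.
Unset Strict Implicit.
Unset Printing Implicit Defensive.

(** * Measure-theoretic preliminaries *)

(** The event [A] may vary with the value of [f]: below, [f] is the past of the urn process and [A]
    prescribes an urn computed from it. *)
Lemma measure_partition (d : measure_display) (R : realType) (T : measurableType d)
    (P : {measure set T -> \bar R}) (I : finType) (f : T -> I) (S : {pred I})
    (A : I -> set T) :
  (forall i, i \in S -> measurable [set w | f w = i /\ A i w]) ->
  P [set w | f w \in S /\ A (f w) w] =
  (\sum_(i in S) P [set w | f w = i /\ A i w])%E.
Proof.
move=> mA.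
have -> : [set w | f w \in S /\ A (f w) w] =
    \bigcup_(i in [set` S]) [set w | f w = i /\ A i w].
  apply/seteqP; split=> w /=; first by move=> [Sf Af]; exists (f w).
  by case=> i /= Si [-> Ai].
rewrite measure_fin_bigcup//.
- rewrite -[RHS]big_enum/= [RHS]fsbig_seq ?enum_uniq//.
  by apply: eq_fsbigl; apply/seteqP; split=> i /=; rewrite mem_enum.
- by move=> i j _ _ [w [[<- _] [<- _]]].
Qed.

(** A preimage is a countable union over pairs [(u, v)], so [f] can be arbitrary. This is applied to
    [jumble_dist] of two random multigraphs. *)
Lemma measurable_fun2_countable (d d1 d2 d3 : measure_display)
    (T : measurableType d) (U : measurableType d1) (V : measurableType d2)
    (W : measurableType d3) (g : T -> U) (h : T -> V) (f : U -> V -> W) :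
  countable [set: U] -> countable [set: V] ->
  (forall u, measurable (g @^-1` [set u])) ->
  (forall v, measurable (h @^-1` [set v])) ->
  measurable_fun [set: T] (fun w => f (g w) (h w)).
Proof.
move=> cU cV mg mh _ B mB; rewrite setTI.
have -> : (fun w => f (g w) (h w)) @^-1` B =
    \bigcup_u \bigcup_v
      (if `[< B (f u v) >] then g @^-1` [set u] `&` h @^-1` [set v] else set0).
  apply/seteqP; split=> w /=.
    by move=> Bw; exists (g w) => //; exists (h w) => //; rewrite asboolT.
  by case=> u _ [v _]; case: asboolP => // Buv [/= -> ->].
apply: countable_bigcupT_measurable => // u.
apply: countable_bigcupT_measurable => // v.
by case: ifP => // _; exact: measurableI.
Qed.

(** * Lower bounds on the jumble distance *)

Lemma jumble_dist_ge0 (R : realType) n (G H : multigraph n) :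
  0 <= jumble_dist R G H.
Proof.
rewrite mulr_ge0// ?invr_ge0//.
by elim/big_ind: _ => // x y x0 y0; rewrite le_max x0.
Qed.

Lemma jumble_dist_ge (R : realType) n (G H : multigraph n) (i j : 'I_n) :
  G i j <> H i j -> n%:R^-1 <= jumble_dist R G H.
Proof.
move=> GH; rewrite -[leLHS]mulr1 ler_wpM2l// ?invr_ge0//.
pose ST : {set 'I_n} * {set 'I_n} := (finset.set1 i, finset.set1 j).
have ST0 : (ST.1 != finset.set0) && (ST.2 != finset.set0).
  by rewrite -!card_gt0 !cards1.
rewrite (bigD1 ST)//= le_max; apply/orP; left.
rewrite !cards1 mulr1 sqrtr1 invr1 mul1r !big_set1.
(* A nonzero integer has absolute value at least 1. *)
have -> : (G i j)%:R - (H i j)%:R = ((G i j)%:Z - (H i j)%:Z)%:~R :> R.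
  by rewrite intrB.
rewrite -intr_norm (ler_int _ 1) -gtz0_ge1 normr_gt0 subr_eq0 eqz_nat.
exact/eqP.
Qed.

(** * Loops in the urn process *)

Lemma sum_balls n (h : seq 'I_n) : (\sum_(u < n) balls h u = n + size h)%N.
Proof.
rewrite big_split/= sum1_card card_ord; congr addn.
elim: h => [|x h IH]/=; first by rewrite big1.
rewrite big_split/= IH (bigD1 x)//= eqxx big1 ?addn0// => i.
by rewrite eq_sym => /negbTE ->.
Qed.

Section UrnProcess.
Context (R : realType) (n m : nat) (d : measure_display) (T : measurableType d)
  (P : probability T R) (X : nat -> T -> 'I_n) (urnX : urn_process m P X).

Definition history t w : t.-tuple 'I_n := [tuple X s w | s < t].

Lemma history_eq t (h : t.-tuple 'I_n) :
  [set w | history t w = h] = [set w | forall s : 'I_t, X s w = tnth h s].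
Proof.
apply/seteqP; split=> w /= => [<- s|Xh]; first by rewrite tnth_mktuple.
by apply: eq_from_tnth => s; rewrite tnth_mktuple Xh.
Qed.

Lemma measurable_history t (h : t.-tuple 'I_n) : (t <= m)%N ->
  measurable [set w | history t w = h].
Proof.
move=> tm; rewrite history_eq.
have -> : [set w | forall s : 'I_t, X s w = tnth h s] =
    \bigcap_(s in [set: 'I_t]) [set w | X s w = tnth h s].
  by apply/seteqP; split=> w /= Xh s; [move=> _|]; apply: Xh.
apply: fin_bigcap_measurable => // s _; apply: urnX.1.
exact: leq_trans tm.
Qed.

Lemma measurable_history_event t (S : {pred t.-tuple 'I_n}) : (t <= m)%N ->
  measurable [set w | history t w \in S].
Proof.
move=> tm.
have -> : [set w | history t w \in S] =
    \bigcup_(h in [set` S]) [set w | history t w = h].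
  by apply/seteqP; split=> w /= => [Sh|[h Sh ->]//]; exists (history t w).
apply: fin_bigcup_measurable; first exact: finite_finpred.
by move=> h _; exact: measurable_history.
Qed.

(** The one-step law is summed over the histories in [S]. The target urn [f h] may depend on the
    past, and the total number of balls is always [n + t]. *)
Lemma urn_step_ge t (S : {pred t.-tuple 'I_n}) (f : t.-tuple 'I_n -> 'I_n) k :
  (t < m)%N -> (forall h, h \in S -> (k <= balls h (f h))%N) ->
  (P [set w | history t w \in S] * (k%:R / (n + t)%:R)%:E <=
   P [set w | history t w \in S /\ X t w = f (history t w)])%E.
Proof.
move=> tm kS.
have mh h := measurable_history h (ltnW tm).
have := @measure_partition _ _ _ P _ (history t) S (fun=> setT).
rewrite (_ : [set w | _ /\ _] = [set w | history t w \in S]); last first.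
  by apply/seteqP; split=> w /=; [case|].
have hT h : [set w | history t w = h /\ [set: T] w] = [set w | history t w = h].
  by apply/seteqP; split=> w /=; [case|].
move=> ->; last by move=> h _; rewrite hT.
rewrite (@measure_partition _ _ _ P _ (history t) S
  (fun h => [set w | X t w = f h])); last first.
  move=> h _; apply: measurableI; first exact: mh.
  exact: (urnX.1 _ (f h) tm).
rewrite ge0_sume_distrl// lee_sum// => h Sh.
rewrite hT.
have -> : [set w | history t w = h /\ [set w | X t w = f h] w] =
    [set w | (forall s : 'I_t, X s w = tnth h s) /\ X t w = f h].
  have /seteqP[h1 h2] := history_eq h.
  by apply/seteqP; split=> w /= [/[dup] hw]; [move/h1|move/h2].
have := urnX.2 t h (f h) tm; rewrite -history_eq sum_balls size_tuple.
move=> step; rewrite [leRHS]step lee_wpmul2l// lee_fin.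
by rewrite ler_wpM2r// ?invr_ge0// ler_nat kS.
Qed.

Definition loopless k : set T :=
  [set w | forall j, (j < k)%N -> X j.*2 w <> X j.*2.+1 w].

(** The length [t] is independent of [k] because the event is also read at time [2k + 1], once the
    first ball of the next pair is placed. The default [v0] is never returned when [2k <= t]. *)
Definition loopless_history (v0 : 'I_n) k t : pred (t.-tuple 'I_n) :=
  fun h => [forall j : 'I_k, nth v0 h j.*2 != nth v0 h j.*2.+1].

Lemma nth_history v0 t s w : (s < t)%N -> nth v0 (history t w) s = X s w.
Proof. by move=> st; rewrite -(tnth_nth v0 _ (Ordinal st)) tnth_mktuple. Qed.

Lemma looplessE v0 k t : (k.*2 <= t)%N ->
  loopless k = [set w | history t w \in @loopless_history v0 k _].
Proof.
move=> kt; have lt1 j : (j < k)%N -> (j.*2.+1 < t)%N.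
  by move=> jk; lia.
apply/seteqP; split=> w /=.
  move=> Lw; apply/forallP => j; rewrite !nth_history ?(ltnW (lt1 _ _))//.
    exact/eqP/Lw.
  exact: lt1.
move=> /forallP Lw j jk; have := Lw (Ordinal jk).
by rewrite /= !nth_history ?(ltnW (lt1 _ _))// ?lt1// => /eqP.
Qed.

Lemma measurable_loopless (v0 : 'I_n) k : (k.*2 <= m)%N ->
  measurable (loopless k).
Proof.
by move=> km; rewrite (@looplessE v0 k k.*2)//; exact: measurable_history_event.
Qed.

(* Given the history up to the first ball of a pair, its urn holds at least two
   of the n + 2k + 1 balls. *)
Lemma loopless_step (v0 : 'I_n) k : (k.*2.+1 < m)%N ->
  (P (loopless k.+1) + P (loopless k) * (2%:R / (n + k.*2.+1)%:R)%:E
    <= P (loopless k))%E.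
Proof.
move=> km.
have mk := @measurable_loopless v0 k ltac:(lia).
have mk1 := @measurable_loopless v0 k.+1 ltac:(lia).
have sub : loopless k.+1 `<=` loopless k by move=> w Lw j jk; apply: Lw; lia.
(* It remains to bound below the probability that the first loop comes from the pair of index
   [k]. *)
rewrite [leRHS](measureDI P mk mk1) addeC (setIidr sub) leeD2r//.
rewrite {1}(@looplessE v0 k k.*2.+1)//.
pose f (h : k.*2.+1.-tuple 'I_n) := nth v0 h k.*2.
rewrite (_ : loopless k `\` loopless k.+1 =
  [set w | history k.*2.+1 w \in @loopless_history v0 k _ /\
           X k.*2.+1 w = f (history k.*2.+1 w)]).
  apply: urn_step_ge => // h _.
  (* Besides its initial ball, the urn [f h] holds the ball recorded at index [2k] of [h]. *)
  by rewrite /balls ltnS -has_count has_pred1 mem_nth// size_tuple.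
have LE := @looplessE v0 k k.*2.+1 (leqnSn _).
apply/seteqP; split=> w /= [Lw]; rewrite /f nth_history//.
  move=> Lw1; split; first by move: Lw; rewrite LE.
  apply: contrapT => Xw; apply: Lw1 => j.
  by rewrite ltnS leq_eqVlt => /orP[/eqP ->|]; [exact/nesym|exact: Lw].
move=> Xw; split; last by move/(_ k (ltnSn k)); rewrite Xw.
by rewrite LE.
Qed.

Lemma loopless_le (v0 : 'I_n) k : (k.*2 <= m)%N ->
  fine (P (loopless k)) <= n%:R / (n + k.*2)%:R.
Proof.
have n0 : (0 < n)%N by case: n v0 => [[]|].
elim: k => [_|k IH km].
  have m0 := @measurable_loopless v0 0 isT.
  rewrite addn0 divff ?pnatr_eq0 -?lt0n// -lee_fin fineK ?fin_num_measure//.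
  exact: probability_le1.
have mk := @measurable_loopless v0 k ltac:(lia).
have mk1 := @measurable_loopless v0 k.+1 ltac:(lia).
have := IH ltac:(lia).
have := @loopless_step v0 k ltac:(lia).
have /fineK <- := fin_num_measure P _ mk.
have /fineK <- := fin_num_measure P _ mk1.
rewrite -EFinM -EFinD lee_fin fineK ?fin_num_measure//=.
have b1 : 1 <= (n + k.*2)%:R :> R by rewrite ler1n; lia.
move: (fine (P _)) (fine (P _)) => p q.
rewrite doubleS !addnS -[(_ + _).+2%:R]natr1 -[(_ + _).+1%:R]natr1.
move: b1; set b : R := _%:R => b1 step qb.
have p_le : p <= q * ((b - 1) / (b + 1)).
  have -> : q * ((b - 1) / (b + 1)) = q - q * (2 / (b + 1)).
    by field; lra.
  by rewrite lerBrDr.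
apply: (le_trans p_le).
apply: (@le_trans _ _ (n%:R / b * ((b - 1) / (b + 1)))).
  by rewrite ler_wpM2r// divr_ge0; lra.
rewrite -mulrA ler_wpM2l// -addrA -[leRHS]div1r ler_pdivlMr; last by lra.
(* This is [(b - 1)(b + 2) = b(b + 1) - 2] divided by [b(b + 1)]. *)
suff : b^-1 * ((b - 1) / (b + 1)) * (b + (1 + 1)) = 1 - 2 / (b * (b + 1)).
  by move=> ->; rewrite gerBl divr_ge0// mulr_ge0; lra.
by field; lra.
Qed.

End UrnProcess.

(** * Loop probabilities in the two models *)

Lemma has_loop_pairing n m (x : nat -> 'I_n) k (v : 'I_n) :
  (k < m./2)%N -> x k.*2 = v -> x k.*2.+1 = v ->
  pairing_graph m x v v <> 0%N.
Proof.
move=> km x0 x1; rewrite mxE (bigD1 (Ordinal km))//= x0 x1 eqxx.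
by rewrite addSn.
Qed.

Definition has_loop n : set (multigraph n) := [set g | exists v, g v v <> 0%N].

Lemma PAG_has_loop (R : realType) (c : R) n (d : measure_display)
    (T : measurableType d) (P : probability T R) (G : {RV P >-> multigraph n}) :
  is_PAG c G -> (0 < n)%N -> n.+1%:R <= c * n%:R ^+ 2 ->
  ((2^-1)%:E <= P (G @^-1` @has_loop n))%E.
Proof.
move=> [d' [T' [P' [X [urnX lawG]]]]] n0 cn.
set m := Num.truncn _ in urnX lawG.
pose v0 := Ordinal n0.
have nm : (n < m)%N by rewrite truncn_ge_nat//; apply: le_trans cn.
have hm : (m./2.*2 <= m)%N by rewrite -{2}(odd_double_half m) leq_addl.
have mL := measurable_loopless urnX v0 hm.
rewrite lawG.
have -> : [set w | has_loop (pairing_graph m (X ^~ w))] = ~` loopless X m./2.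
  apply/seteqP; split=> w /=.
    move=> [v] /= Gv Lw; apply: Gv; rewrite mxE big1// => k _.
    apply/eqP; rewrite eqb0; apply/negP => kv; apply: (Lw k (ltn_ord k)).
    by case/orP: kv => /eqP[-> ->].
  move=> Lw; apply: contrapT => nl; apply: Lw => k km Xk; apply: nl.
  exists (X k.*2 w); exact: has_loop_pairing km _ _.
rewrite probability_setC// -(fineK (fin_num_measure P' _ mL)) -EFinB lee_fin.
have := loopless_le urnX v0 hm; set p := fine _.
(* The strict inequality [n < m] makes up for the unpaired last ball when [m] is odd: the paired
   balls still number at least [n]. *)
have : n%:R / (n + m./2.*2)%:R <= 2^-1 :> R.
  rewrite ler_pdivrMr ?ltr0n ?addn_gt0 ?n0// ler_pdivlMl// -natrM ler_nat.
  by move: (odd_double_half m) nm; lia.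
lra.
Qed.

Lemma GW_has_loop (R : realType) (c : R) n (d : measure_display)
    (T : measurableType d) (P : probability T R) (H : {RV P >-> multigraph n}) :
  is_GW c H -> P (H @^-1` @has_loop n) = 0%E.
Proof.
move=> [d' [T' [P' [xi [Y [_ _ ->]]]]]].
rewrite (_ : [set w | _] = set0) ?measure0//.
by apply/seteqP; split=> w //= [v] /=; rewrite mxE ltnn.
Qed.

(** Where [G] lies in [A] and [H] does not, the graphs differ, so their distance is at least [1/n].
    The left side depends only on the two laws, which makes the bound uniform over couplings. *)
Lemma expectation_jumble_dist_ge (R : realType) n (d : measure_display)
    (T : measurableType d) (P : probability T R)
    (G H : {RV P >-> multigraph n}) (A : set (multigraph n)) :
  ((n%:R^-1)%:E * (P (G @^-1` A) - P (H @^-1` A)) <=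
   'E_P[fun w => jumble_dist R (G w) (H w)])%E.
Proof.
have mGA B : measurable (G @^-1` B).
  by rewrite -[_ @^-1` _]setTI; exact: measurable_funPT.
have mHA B : measurable (H @^-1` B).
  by rewrite -[_ @^-1` _]setTI; exact: measurable_funPT.
pose D := G @^-1` A `\` H @^-1` A.
have mD : measurable D by exact: measurableD.
rewrite unlock.
apply: (@le_trans _ _ (\int[P]_w (n%:R^-1 * \1_D w)%:E)%E); last first.
  apply: ge0_le_integral => //.
  - by apply/measurable_EFinP; apply: measurable_funM.
  - apply/measurable_EFinP.
    by apply: measurable_fun2_countable => //; exact: countableP.
  move=> w _; rewrite lee_fin indicE; case: (boolP (w \in D)) => wD; last first.
    by rewrite mulr0 jumble_dist_ge0.
  rewrite mulr1; move/set_mem: wD => [GA HA].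
  apply: contrapT => /negP; rewrite -ltNge => lt.
  apply: HA; suff GHw : G w = H w by rewrite /preimage/= -GHw.
  apply/val_inj/matrixP => i j; apply: contrapT => /(jumble_dist_ge R).
  by rewrite leNgt lt.
under eq_integral do rewrite EFinM.
rewrite ge0_integralZl//; last by apply/measurable_EFinP.
rewrite integral_indic// setIT lee_wpmul2l ?lee_fin ?invr_ge0//.
rewrite leeBlDr ?fin_num_measure//.
apply: le_trans (measureU2 _ _ _) => //.
apply: le_measure; rewrite ?inE//; first exact: measurableU.
by move=> w Gw; case: (pselect (A (H w))); [right|left].
Qed.

Unset Implicit Arguments.

Theorem mainTheorem2 (R : realType) (c : R) (c_gt0 : 0 < c) :
  exists (c0 : R) (n0 : nat), 0 < c0 /\
    forall n : nat, (n0 <= n)%N ->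
    forall (d : measure_display) (T : measurableType d) (P : probability T R)
      (G H : {RV P >-> multigraph n}),
      is_PAG c G -> is_GW c H ->
      ((c0 / n%:R)%:E <= 'E_P[fun w => jumble_dist R (G w) (H w)])%E.
Proof.
(* The constant is the lower bound on the loop probability. The threshold on [n] gives [c n >= 2],
   hence [c n^2 >= 2n >= n + 1]. *)
exists 2^-1, (Num.truncn (2 / c)).+1; split=> [|n nc d T P G H PAG GW].
  by rewrite invr_gt0.
have n0 : (0 < n)%N by exact: leq_trans nc.
have cn : 2 <= c * n%:R.
  rewrite mulrC -ler_pdivrMr//; apply: le_trans (ltW (truncnS_gt _)) _.
  by rewrite ler_nat.
have n1 : 1 <= n%:R :> R by rewrite ler1n.
have := PAG_has_loop PAG n0.
have -> : n.+1%:R <= c * n%:R ^+ 2 by rewrite -natr1; nra.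
move=> /(_ isT) half.
apply: le_trans (expectation_jumble_dist_ge G H (@has_loop n)).
by rewrite (GW_has_loop GW) sube0 mulrC EFinM lee_wpmul2l.
Qed.
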